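(* Let $R$ be an order in a number field $K$, let $\overline{R}=\mathcal{O}_K$, and let $I=(R:\overline{R})$ be the conductor ideal of $R$. Suppose that $R$ is an associated order and that $I$ is a radical ideal of $\overline{R}$. Then for every nonzero nonunit $f\in R[[x]]$, $\rho_{R[[x]]}(f)=\rho_{\overline{R}[[x]]}(f)$. Moreover, $\rho(R[[x]])=\rho(\overline{R}[[x]])$.
   Context: An order $R$ in a number field $K$ is a subring (with $1$) of the ring of integers $\mathcal{O}_K$ that has rank $[K:\mathbb{Q}]$ as a $\mathbb{Z}$-module; its integral closure is $\overline{R}=\mathcal{O}_K$. The conductor ideal is $I=(R:\overline{R})=\{t\in\overline{R}: t\overline{R}\subseteq R\}$, the largest ideal of $\overline{R}$ contained in $R$. Saying $I$ is radical means it is radical as an ideal of $\overline{R}$, i.e. a (possibly empty) product of distinct nonzero prime ideals of $\overline{R}$. $U(\cdot)$ denotes the unit group. $R$ is an associated order if $\overline{R}=R\cdot U(\overline{R})$, i.e. every $t\in\overline{R}$ can be written $t=ru$ with $r\in R$, $u\in U(\overline{R})$. For an atomic domain $D$ and a nonzero nonunit $a\in D$, let $\ell_D(a)$ be the set of all $n$ such that $a$ is a product of $n$ irreducible elements of $D$; the elasticity of $a$ is $\rho_D(a)=\sup \ell_D(a)/\min \ell_D(a)$, and the elasticity of $D$ is $\rho(D)=\sup\{\rho_D(a): a\in D \text{ a nonzero nonunit}\}\in[1,\infty]$. $R[[x]]$ and $\overline{R}[[x]]$ are rings of formal power series in one variable. *)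

(* Defs.v *)
From HB Require Import structures.
From mathcomp Require Import all_boot all_order all_algebra all_field.
From mathcomp Require Import all_classical all_reals ereal.

Set Implicit Arguments.
Unset Strict Implicit.
Unset Printing Implicit Defensive.

Import Order.TTheory GRing.Theory Num.Theory.

Local Open Scope classical_set_scope.
Local Open Scope ring_scope.

(* The ring A[[x]]; a series is given by its coefficients, and the product    *)
(* is the Cauchy product.                                                     *)
Record fps (A : Type) := Fps { fcoef : nat -> A }.

Section FpsRing.
Variable A : comNzRingType.
Implicit Types f g h : fps A.

HB.instance Definition _ := gen_eqMixin (fps A).
HB.instance Definition _ := gen_choiceMixin (fps A).

Lemma fpsP f g : (forall n, fcoef f n = fcoef g n) <-> f = g.
Proof.
split=> [|-> //]; case: f => f; case: g => g /= fg.
by congr Fps; apply/funext.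
Qed.

Definition fps_const (a : A) : fps A := Fps (fun n => if n is 0%N then a else 0).
Definition fps_opp f : fps A := Fps (fun n => - fcoef f n).
Definition fps_add f g : fps A := Fps (fun n => fcoef f n + fcoef g n).
Definition fps_mul f g : fps A :=
  Fps (fun n => \sum_(i < n.+1) fcoef f i * fcoef g (n - i)%N).

Lemma fps_addA : associative fps_add.
Proof. by move=> f g h; apply/fpsP => n /=; rewrite addrA. Qed.

Lemma fps_addC : commutative fps_add.
Proof. by move=> f g; apply/fpsP => n /=; rewrite addrC. Qed.

Lemma fps_add0 : left_id (fps_const 0) fps_add.
Proof. by move=> f; apply/fpsP => -[|n] /=; rewrite add0r. Qed.

Lemma fps_addN : left_inverse (fps_const 0) fps_opp fps_add.
Proof. by move=> f; apply/fpsP => -[|n] /=; rewrite addNr. Qed.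

HB.instance Definition _ :=
  GRing.isZmodule.Build (fps A) fps_addA fps_addC fps_add0 fps_addN.

Definition fps_trunc (m : nat) f : {poly A} := \poly_(i < m) fcoef f i.

Lemma fcoef_mul_trunc m f g n : (n < m)%N ->
  fcoef (fps_mul f g) n = (fps_trunc m f * fps_trunc m g)`_n.
Proof.
move=> nm; rewrite coefM /=; apply: eq_bigr => i _.
rewrite !coef_poly (leq_ltn_trans _ nm) ?leq_ord //.
by rewrite (leq_ltn_trans (leq_subr i n) nm).
Qed.

Lemma fps_mulA : associative fps_mul.
Proof.
move=> f g h; apply/fpsP => n.
transitivity ((fps_trunc n.+1 f * (fps_trunc n.+1 g * fps_trunc n.+1 h))`_n).
  rewrite coefM /=; apply: eq_bigr => i _.
  rewrite coef_poly ltn_ord; congr (_ * _).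
  by rewrite -(@fcoef_mul_trunc n.+1) // ltnS leq_subr.
rewrite mulrA coefM /=; apply: eq_bigr => i _.
rewrite -(@fcoef_mul_trunc n.+1) //; congr (_ * _).
by rewrite coef_poly ltnS leq_subr.
Qed.

Lemma fps_mulC : commutative fps_mul.
Proof.
move=> f g; apply/fpsP => n.
by rewrite !(@fcoef_mul_trunc n.+1) // mulrC.
Qed.

Lemma fps_mul1 : left_id (fps_const 1) fps_mul.
Proof.
move=> f; apply/fpsP => n /=.
rewrite big_ord_recl /= mul1r subn0 big1 ?addr0 // => i _.
by rewrite mul0r.
Qed.

Lemma fps_mulD : left_distributive fps_mul fps_add.
Proof.
move=> f g h; apply/fpsP => n /=.
by rewrite -big_split; apply: eq_bigr => i _; rewrite mulrDl.
Qed.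

Lemma fps_oner_neq0 : fps_const 1 != 0 :> fps A.
Proof.
by apply/eqP => /fpsP/(_ 0%N)/= /eqP; rewrite oner_eq0.
Qed.

HB.instance Definition _ := GRing.Zmodule_isComNzRing.Build (fps A)
  fps_mulA fps_mulC fps_mul1 fps_mulD fps_oner_neq0.

End FpsRing.

(* Factorization in a domain D, presented as a subring of a commutative ring  *)
(* L: units, irreducibles and factorizations all refer to D, not to L.        *)
Section Factorization.
Variables (L : comNzRingType) (D : set L).

Definition units : set L := [set u | D u /\ exists2 v, D v & u * v = 1].

Definition nonzero_nonunit : set L := [set a | [/\ D a, a <> 0 & ~ units a]].

Definition irreducibles : set L :=
  [set p | nonzero_nonunit p /\
     forall a b, D a -> D b -> p = a * b -> units a \/ units b].

Definition lengths (a : L) : set nat :=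
  [set n | exists p : 'I_n -> L,
     (forall i, irreducibles (p i)) /\ a = \prod_(i < n) p i].

End Factorization.

(* The least element of A when A is nonempty. *)
Definition min_nat (A : set nat) : nat :=
  xget 0%N [set m | A m /\ forall n, A n -> (m <= n)%N].

(* Elasticities are extended reals over a realType F, so that the suprema     *)
(* always exist. In an atomic domain the set of lengths of a nonzero nonunit  *)
(* is nonempty and consists of positive integers.                             *)
Section Elasticity.
Variables (F : realType) (L : comNzRingType) (D : set L).
Local Open Scope ereal_scope.

Definition elasticity_at (a : L) : \bar F :=
  ereal_sup [set (n%:R%:E : \bar F) | n in lengths D a]
    / (min_nat (lengths D a))%:R%:E.

Definition elasticity : \bar F :=
  ereal_sup [set elasticity_at a | a in nonzero_nonunit D].

End Elasticity.

Section Orders.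
Variable K : fieldExtType rat.

Definition ring_of_integers : set K :=
  [set z | integralOver (intr : int -> K) z].

Definition Z_independent n (e : 'I_n -> K) : Prop :=
  forall c : 'I_n -> int, \sum_(i < n) e i *~ c i = 0 -> forall i, c i = 0.

(* The maximal number of Z-linearly independent elements of M is r.           *)
Definition has_Z_rank (M : set K) (r : nat) : Prop :=
  (exists e : 'I_r -> K, (forall i, M (e i)) /\ Z_independent e) /\
  (forall n (e : 'I_n -> K),
     (forall i, M (e i)) -> Z_independent e -> (n <= r)%N).

Definition is_order (R : set K) : Prop :=
  [/\ subring_closed (mem R),
      R `<=` ring_of_integers &
      has_Z_rank R (\dim {:K})].

Definition conductor (R : set K) : set K :=
  [set t | ring_of_integers t /\
     forall s, ring_of_integers s -> R (t * s)].

(* J is radical as an ideal of A; J = A is allowed.                           *)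
Definition is_radical (A J : set K) : Prop :=
  [set t | A t /\ exists2 n, (0 < n)%N & J (t ^+ n)] = J.

Definition is_associated (R : set K) : Prop :=
  forall t, ring_of_integers t ->
    exists r u, [/\ R r, units ring_of_integers u & t = r * u].

End Orders.

(* B[[x]] inside A[[x]].                                                      *)
Definition fps_over (A : Type) (B : set A) : set (fps A) :=
  [set f | forall n, B (fcoef f n)].

(* Main.v *)
Require Import Defs.
From mathcomp Require Import all_boot all_order all_algebra all_field.
From mathcomp Require Import all_classical all_reals ereal.
From mathcomp Require Import ring.

Set Implicit Arguments.
Unset Strict Implicit.
Unset Printing Implicit Defensive.

Import Order.TTheory GRing.Theory Num.Theory.

Local Open Scope classical_set_scope.
Local Open Scope ring_scope.

(** Write O for the ring of integers and I for the conductor. The heart of the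
    matter is a splitting property: if a product [a * b] of two series over O
    has its coefficients in R, then some unit w of O[[x]] moves both factors
    into R[[x]], that is, [a * w] and [b / w] have coefficients in R
    ([unit_split]). Given that, a factorization in O[[x]] of an element of
    R[[x]] can be corrected, one factor at a time, by units of O[[x]] until all
    factors lie in R[[x]]. Since every unit of O[[x]] that lies in R[[x]] is a
    unit of R[[x]], the irreducibles of R[[x]] are those of O[[x]] that lie in
    R[[x]], and both rings give the same lengths to the elements of R[[x]]
    ([lengths_eq]). Splitting a product [f * 0] shows that every f in O[[x]]
    has an associate in R[[x]], so both elasticities are suprema of the same
    set of values.

    The splitting property is decided modulo I, since I is contained in R. The
    quotient O / I is finite because R has full rank: the trace form of K
    bounds the denominators of integers with respect to a basis in R
    ([ring_of_integers_denominator]), so that I contains a nonzero integer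
    multiple of O. It is reduced because I is radical. A finite reduced ring
    satisfies an identity [t ^+ N.+2 = t] ([finite_quotient_pow]), so [t ^+ N.+1] is the
    idempotent that generates the same ideal as t. Writing [t = r * u] with r
    in R and u a unit shows that this idempotent is [r ^+ N.+1], hence lies in
    the image of R ([pow_in_R]).

    These idempotents cut O / I into finitely many orthogonal pieces. On each
    piece either a is a power of x times an invertible series, or b is, or both
    vanish, and in all three cases a unit that splits [a * b] can be written
    down ([splits_on_lead], [splits_on_kernel]). The pieces are glued with
    [splits_on_add], which gives a series w invertible modulo I. That O is
    [R * U(O)] is used a second time to change w, by a factor from R and a
    term from I, into a series whose constant coefficient is a unit of O. *)

(** * Subrings given as sets, and the series over them *)

Section SubringSets.
Variables (A : comNzRingType) (B : set A).
Hypothesis B_ring : subring_closed (mem B).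
Implicit Types x y : A.

Lemma subring1 : B 1.
Proof. by case: B_ring => /set_mem. Qed.

Lemma subringB x y : B x -> B y -> B (x - y).
Proof.
by case: B_ring => _ BB _ /mem_set Bx /mem_set By; apply/set_mem/BB.
Qed.

Lemma subringM x y : B x -> B y -> B (x * y).
Proof.
by case: B_ring => _ _ BM /mem_set Bx /mem_set By; apply/set_mem/BM.
Qed.

Lemma subring0 : B 0.
Proof. by rewrite -(subrr 1); apply: subringB; apply: subring1. Qed.

Lemma subringN x : B x -> B (- x).
Proof. by move=> Bx; rewrite -sub0r; apply: subringB => //; apply: subring0. Qed.

Lemma subringD x y : B x -> B y -> B (x + y).
Proof. by move=> Bx By; rewrite -(opprK y); apply: subringB => //; apply: subringN. Qed.

Lemma subringX x n : B x -> B (x ^+ n).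
Proof.
move=> Bx; elim: n => [|n IH]; first exact: subring1.
by rewrite exprS; apply: subringM.
Qed.

Lemma subring_sum (T : Type) (s : seq T) (P : pred T) (f : T -> A) :
  (forall i, P i -> B (f i)) -> B (\sum_(i <- s | P i) f i).
Proof.
by move=> Bf; apply: (big_ind B) => //; [apply: subring0 | apply: subringD].
Qed.

Lemma subring_int (m : int) : B m%:~R.
Proof.
have Bn n : B n%:R.
  elim: n => [|n IH]; first exact: subring0.
  by rewrite -natr1; apply: subringD => //; exact: subring1.
by case: m => n; [apply: Bn | rewrite NegzE mulrNz; apply/subringN/(Bn n.+1)].
Qed.

Lemma subring_closed_fps_over : subring_closed (mem (fps_over B)).
Proof.
split=> [|f g /set_mem Bf /set_mem Bg|f g /set_mem Bf /set_mem Bg];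
  apply/mem_set.
- by case=> [|n] /=; [apply: subring1 | apply: subring0].
- by move=> n /=; apply: subringB.
- by move=> n; apply: subring_sum => i _; apply: subringM.
Qed.

Lemma fps_over_const c : B c -> fps_over B (fps_const c).
Proof. by move=> Bc [|n] //=; apply: subring0. Qed.

End SubringSets.

(** * Coefficients and inverses of power series *)

Section FpsCoefficients.
Variable A : comNzRingType.
Implicit Types (f g : fps A) (c d : A).

Definition fps_Xn (n : nat) : fps A := Fps (fun k => (k == n)%:R).

Lemma fcoefD f g n : fcoef (f + g) n = fcoef f n + fcoef g n.
Proof. by []. Qed.

Lemma fcoefB f g n : fcoef (f - g) n = fcoef f n - fcoef g n.
Proof. by []. Qed.

Lemma fcoef_cM c f n : fcoef (fps_const c * f) n = c * fcoef f n.
Proof.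
rewrite [LHS]/= big_ord_recl /= subn0 big1 ?addr0 // => i _.
by rewrite mul0r.
Qed.

Lemma fps_constM c d : fps_const (c * d) = fps_const c * fps_const d.
Proof. by apply/fpsP => n; rewrite fcoef_cM; case: n => //= n; rewrite mulr0. Qed.

Lemma fps_constB c d : fps_const (c - d) = fps_const c - fps_const d.
Proof. by apply/fpsP => -[|n] //=; rewrite subrr. Qed.

Lemma fps_constD c d : fps_const (c + d) = fps_const c + fps_const d.
Proof. by apply/fpsP => -[|n] //=; rewrite addr0. Qed.

Lemma fcoef_XnM n f k :
  fcoef (fps_Xn n * f) k = if (k < n)%N then 0 else fcoef f (k - n).
Proof.
rewrite [LHS]/=; case: ltnP => kn.
  rewrite big1 // => i _; case: eqP => [ein|]; last by rewrite mul0r.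
  by have := ltn_ord i; rewrite ltnS ein leqNgt kn.
rewrite -ltnS in kn; rewrite (bigD1 (Ordinal kn)) //= eqxx mul1r big1 ?addr0 //.
by move=> i /negPf ik; rewrite -val_eqE /= in ik; rewrite ik mul0r.
Qed.

Lemma fcoef_exp0 f n k : fcoef f 0 = 0 -> (k < n)%N -> fcoef (f ^+ n) k = 0.
Proof.
move=> f0; elim: n k => // n IH k; rewrite ltnS => kn.
rewrite exprS [LHS]/= big1 // => i _.
case: i => -[|i] /= ik; first by rewrite f0 mul0r.
rewrite IH ?mulr0 //; apply: leq_trans kn.
by rewrite ltnS in ik; rewrite ltn_subrL /= (leq_trans _ ik).
Qed.

(** The inverse is the geometric series in [1 - f]: only its first [n + 1]
    terms contribute to the coefficient of degree [n]. *)
Lemma fps_inverse1 (B : set A) f : subring_closed (mem B) ->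
  fps_over B f -> fcoef f 0 = 1 -> exists2 h, fps_over B h & f * h = 1.
Proof.
move=> B_ring Bf f0; have fB_ring := subring_closed_fps_over B_ring.
pose T n := \sum_(i < n) (1 - f) ^+ i.
have gE n : f * T n = 1 - (1 - f) ^+ n.
  by rewrite -(opprB (_ ^+ n)) subrX1 /T; ring.
have g0 : fcoef (1 - f) 0 = 0 by rewrite fcoefB f0 subrr.
have T_stable k m : (k < m)%N -> fcoef (T m) k = fcoef (T k.+1) k.
  elim: m => // m IH; rewrite ltnS leq_eqVlt => /predU1P[->//|km].
  by rewrite /T big_ord_recr fcoefD fcoef_exp0 // addr0 IH.
exists (Fps (fun n => fcoef (T n.+1) n)).
  move=> n /=; suff BT : fps_over B (T n.+1) by exact: BT.
  apply: (subring_sum fB_ring) => i _; apply: (subringX fB_ring).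
  by apply: (subringB fB_ring) => //; apply: (subring1 fB_ring).
apply/fpsP => n.
have -> : fcoef 1 n = fcoef (f * T n.+1) n.
  by rewrite gE fcoefB fcoef_exp0 ?subr0.
apply: eq_bigr => i _ /=; congr (_ * _).
by rewrite [RHS]T_stable // ltnS leq_subr.
Qed.

Lemma fps_inverse (B : set A) f u : subring_closed (mem B) ->
  fps_over B f -> B u -> fcoef f 0 * u = 1 ->
  exists2 h, fps_over B h & f * h = 1.
Proof.
move=> B_ring Bf Bu fu; have fB_ring := subring_closed_fps_over B_ring.
have Buf : fps_over B (fps_const u * f).
  by apply: (subringM fB_ring) => //; apply: (fps_over_const B_ring).
have [|h Bh fh] := fps_inverse1 B_ring Buf; first by rewrite fcoef_cM mulrC.
exists (fps_const u * h); last by rewrite -fh; ring.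
by apply: (subringM fB_ring) => //; apply: (fps_over_const B_ring).
Qed.

Lemma fps_over_units (B C : set A) : subring_closed (mem B) ->
  (forall u, B u -> units C u -> units B u) ->
  forall f, fps_over B f -> units (fps_over C) f -> units (fps_over B) f.
Proof.
move=> B_ring BC f Bf [Cf [g Cg fg]]; split=> //.
have f0U : units C (fcoef f 0).
  split=> //; exists (fcoef g 0) => //.
  by have := congr1 (fun h => fcoef h 0) fg; rewrite /= big_ord_recl big_ord0 addr0.
have [_ [u Bu f0u]] := BC _ (Bf 0%N) f0U.
by have [h Bh fh] := fps_inverse B_ring Bf Bu f0u; exists h.
Qed.

End FpsCoefficients.

(** * Splitting a product over the smaller ring *)

Section Splitting.
Variables (A : comNzRingType) (O R I : set A).
Hypothesis O_ring : subring_closed (mem O).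
Hypothesis R_ring : subring_closed (mem R).
Hypothesis RO : R `<=` O.
Hypothesis IR : I `<=` R.
Hypothesis ID : forall x y, I x -> I y -> I (x + y).
Hypothesis IM : forall t x, O t -> I x -> I (t * x).
Hypothesis I0 : I 0.
Variable N : nat.
Hypothesis O_pow : forall t, O t -> I (t ^+ N.+2 - t).
Hypothesis OR : forall t, O t -> exists r u, [/\ R r, units O u & t = r * u].
Hypothesis O_fin : forall a : nat -> A, (forall n, O (a n)) ->
  exists M, forall n, exists2 m, (m < M)%N & I (a n - a m).

Implicit Types (x y t c d e : A) (f g a b w : fps A).

Notation fO := (fps_over O).
Notation fR := (fps_over R).
Notation fI := (fps_over I).

Let fO_ring : subring_closed (mem fO) := subring_closed_fps_over O_ring.
Let fR_ring : subring_closed (mem fR) := subring_closed_fps_over R_ring.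

Let fRO : fR `<=` fO. Proof. by move=> f Rf n; apply: RO. Qed.
Let fIR : fI `<=` fR. Proof. by move=> f If n; apply: IR. Qed.
Let IO : I `<=` O. Proof. by move=> x /IR /RO. Qed.

Let fID f g : fI f -> fI g -> fI (f + g).
Proof. by move=> If Ig n; apply: ID. Qed.

Let fIM f g : fO f -> fI g -> fI (f * g).
Proof.
move=> Of Ig n; by apply: (big_ind I) => // i _; apply: IM.
Qed.

Let IMr x t : I x -> O t -> I (x * t).
Proof. by move=> Ix Ot; rewrite mulrC; apply: IM. Qed.

Let fIMr f g : fI f -> fO g -> fI (f * g).
Proof. by move=> If Og; rewrite mulrC; apply: fIM. Qed.

Let IN x : I x -> I (- x).
Proof.
move=> Ix; rewrite -mulN1r; apply: IM => //.
by apply/(subringN O_ring)/(subring1 O_ring).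
Qed.

Let fIN f : fI f -> fI (- f).
Proof. by move=> If n; apply: IN. Qed.

Let IB x y : I x -> I y -> I (x - y).
Proof. by move=> Ix Iy; apply/ID/IN. Qed.

Let fIB f g : fI f -> fI g -> fI (f - g).
Proof. by move=> If Ig; apply/fID/fIN. Qed.

Let fI_const c : I c -> fI (fps_const c).
Proof. by move=> Ic [|n]. Qed.

Local Ltac inO := repeat first [assumption | apply: (subringB O_ring)
  | apply: (subringD O_ring) | apply: (subringM O_ring) | apply: (subringX O_ring)
  | apply: (subring1 O_ring) | apply: (subring0 O_ring) | apply: RO; assumption].

Local Ltac inR := repeat first [assumption | apply: (subringB R_ring)
  | apply: (subringD R_ring) | apply: (subringM R_ring) | apply: (subringX R_ring)
  | apply: (subring1 R_ring) | apply: (subring0 R_ring)].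

Local Ltac infO := repeat first [assumption | apply: (subringB fO_ring)
  | apply: (subringD fO_ring) | apply: (subringM fO_ring)
  | apply: (subring1 fO_ring) | apply: fRO; assumption
  | apply: (fps_over_const O_ring) | apply: RO; assumption].

Local Ltac infR := repeat first [assumption | apply: (subringB fR_ring)
  | apply: (subringD fR_ring) | apply: (subringM fR_ring)
  | apply: (subring1 fR_ring) | apply: (fps_over_const R_ring)].

(** After multiplication by [c], the constant coefficient differs from 1 by an
    element of [I]; subtracting that element gives a series with a genuine
    inverse. *)
Lemma inverse_mod f c : fO f -> O c -> I (fcoef f 0 * c - 1) ->
  exists2 h, fO h & fI (f * h - 1).
Proof.
move=> Of Oc Ifc; set i := _ - 1 in Ifc.
have [||h Oh hE] := fps_inverse1 O_ring (f := fps_const c * f - fps_const i).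
- by infO; apply: IO.
- by rewrite fcoefB fcoef_cM /= /i; ring.
exists (fps_const c * h); first by infO.
have -> : f * (fps_const c * h) - 1 = fps_const i * h by rewrite -hE; ring.
by apply: fIMr => //; apply: fI_const.
Qed.

(** The splitting property localized at an idempotent [E] of the quotient by
    [I]: [w] and [w'] live on [E] and are inverse to each other there. Asking
    that they vanish off [E] modulo [I] makes the splittings on orthogonal
    idempotents add up. *)
Definition splits_on a b E := exists w w',
  [/\ fO w /\ fO w', fI (w * w' - E), fI (E * w - w) /\ fI (E * w' - w'),
      fR (a * w) & fR (b * w')].

Lemma splits_on_sym a b E : splits_on a b E -> splits_on b a E.
Proof.
move=> [w [w' [[Ow Ow'] ww' [Ew Ew'] aw bw']]].
by exists w', w; split=> //; rewrite mulrC.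
Qed.

Lemma splits_on_mul a b D E : fR D -> fI (D * D - D) -> fR E ->
  splits_on a b E -> splits_on a b (D * E).
Proof.
move=> RD D2 RE [w [w' [[Ow Ow'] ww' [Ew Ew'] aw bw']]].
have DE (x : fps A) : fO x -> fI (E * x - x) -> fI (D * E * (D * x) - D * x).
  move=> Ox Ex.
  rewrite [X in fI X](_ : _ = D * D * (E * x - x) + (D * D - D) * x); last ring.
  by apply: fID; [apply: fIM | apply: fIMr] => //; infO.
exists (D * w), (D * w'); split; try by rewrite mulrCA; infR.
- by split; infO.
- rewrite [X in fI X](_ : _ = D * D * (w * w' - E) + (D * D - D) * E); last ring.
  by apply: fID; [apply: fIM | apply: fIMr] => //; infO.
- by split; apply: DE.
Qed.

(** Supports being orthogonal, the mixed products [w * v'] and [v * w'] vanish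
    modulo [I], so [w + v] and [w' + v'] are inverse to each other on
    [D + E]. *)
Lemma splits_on_add a b D E : fR D -> fR E -> fI (D * E) ->
  splits_on a b D -> splits_on a b E -> splits_on a b (D + E).
Proof.
move=> RD RE DE [w [w' [[Ow Ow'] ww' [Dw Dw'] aw bw']]].
move=> [v [v' [[Ov Ov'] vv' [Ev Ev'] av bv']]].
have orth (x y : fps A) : fO x -> fO y -> fI (D * x - x) -> fI (E * y - y) -> fI (x * y).
  move=> Ox Oy Dx Ey.
  rewrite [X in fI X](_ : _ = D * E * (x * y) - (E * y) * (D * x - x)
    - x * (E * y - y)); last ring.
  apply: fIB; last by apply: fIM.
  by apply: fIB; [apply: fIMr | apply: fIM] => //; infO.
have cross (x y : fps A) : fO x -> fO y -> fI (D * x - x) -> fI (E * y - y) ->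
    fI ((D + E) * (x + y) - (x + y)).
  move=> Ox Oy Dx Ey.
  rewrite [X in fI X](_ : _ = (D * x - x) + (E * y - y)
    + (D * E * (x + y) - E * (D * x - x) - D * (E * y - y))); last ring.
  apply: fID; first exact: fID.
  apply: fIB; last by apply: fIM => //; infO.
  by apply: fIB; [apply: fIMr => //; infO | apply: fIM => //; infO].
exists (w + v), (w' + v'); split; try by rewrite mulrDr; infR.
- by split; infO.
- rewrite [X in fI X](_ : _ = (w * w' - D) + (v * v' - E) + (w * v' + w' * v));
    last ring.
  by do 2!apply: fID => //; apply: orth.
- by split; apply: cross.
Qed.

(** Where both factors vanish any unit will do, for instance [D] itself. *)
Lemma splits_on_kernel a b D : fO a -> fO b -> fR D -> fI (D * D - D) ->
  fI (D * a) -> fI (D * b) -> splits_on a b D.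
Proof.
move=> Oa Ob RD D2 Da Db; exists D, D; split=> //; first by split; infO.
- by rewrite mulrC; apply: fIR.
- by rewrite mulrC; apply: fIR.
Qed.

Lemma pow_idem t (e := t ^+ N.+1) : O t -> I (e * e - e).
Proof.
move=> Ot; have -> : e * e - e = t ^+ N * (t ^+ N.+2 - t) by rewrite /e !exprS; ring.
by apply: IM; [inO | apply: O_pow].
Qed.

Lemma pow_unit u u' : O u -> O u' -> I (u * u' - 1) -> I (u ^+ N.+1 - 1).
Proof.
move=> Ou Ou' uu'; rewrite [X in I X](_ : _ =
  u' * (u ^+ N.+2 - u) - (u * u' - 1) * (u ^+ N.+1 - 1)); last first.
  by rewrite !exprS; ring.
by apply: IB; [apply: IM => //; apply: O_pow | apply: IMr => //; inO].
Qed.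

(** This is where associatedness enters: in [t = r * u] the power of the unit
    [u] is 1 modulo [I], so [t ^+ N.+1] and [r ^+ N.+1] agree modulo [I]. *)
Lemma pow_in_R t : O t -> R (t ^+ N.+1).
Proof.
move=> /OR[r [u [Rr [Ou [v Ov uv]] ->]]].
have Iu : I (u ^+ N.+1 - 1).
  by apply: (pow_unit Ou Ov); rewrite uv subrr.
rewrite exprMn -[u ^+ _](subrK 1) mulrDr mulr1.
apply: (subringD R_ring); last by inR.
by apply/IR/IM => //; inO.
Qed.

(** On the idempotent [e] the first coefficient of [a] that does not vanish is
    that of degree [n], and it is invertible there. So [a] is ['X^n * v] with
    [v] invertible on [e], and the pair [v^-1, v] splits the product: [a / v]
    becomes ['X^n], while [b * v] is [a * b] with its coefficients shifted by
    [n]. *)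
Lemma splits_on_lead a b d n (e := d * fcoef a n ^+ N.+1) :
  fO a -> fO b -> fR (a * b) -> R d -> I (d * d - d) ->
  (forall m, (m < n)%N -> I (d * fcoef a m)) -> splits_on a b (fps_const e).
Proof.
move=> Oa Ob Rab Rd d2 da.
have Rt : R (fcoef a n ^+ N.+1) by apply: pow_in_R.
have Re : R e by inR.
have e2 : I (e * e - e).
  rewrite [X in I X](_ : _ = d * d * (fcoef a n ^+ N.+1 * fcoef a n ^+ N.+1
    - fcoef a n ^+ N.+1) + (d * d - d) * fcoef a n ^+ N.+1); last first.
    by rewrite /e; ring.
  by apply: ID; [apply: IM; [inO | apply: pow_idem] | apply: IMr => //; inO].
pose E := fps_const e; have RE : fR E by infR.
have E2 : fI (E * E - E) by rewrite -fps_constM -fps_constB; apply: fI_const.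
pose v := Fps (fun k => e * fcoef a (n + k)).
have Ov : fO v by move=> k /=; inO; apply: Oa.
have Ea : fI (E * a - fps_Xn _ n * v).
  move=> k; rewrite fcoefB fcoef_cM fcoef_XnM; case: ltnP => kn.
    rewrite subr0 /e mulrAC; apply: IMr; [exact: da | inO; exact: Oa].
  by rewrite /= subnKC // subrr.
have Ev : fI (E * v - v).
  move=> k; rewrite fcoefB fcoef_cM /= mulrA -mulrBl.
  by apply: IMr => //; apply: Oa.
(* Adding [1 - E] makes [v] invertible off [E] too, so it can be inverted. *)
pose V := v + (1 - E).
have OV : fO V by infO.
have Oan : O (fcoef a n) by apply: Oa.
have [||Z OZ VZ] := inverse_mod (c := e * fcoef a n ^+ N + (1 - e)) OV.
- by inO.
- rewrite [X in I X](_ : _ = (e * e - e) * (fcoef a n ^+ N.+1 - fcoef a n ^+ N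
    - fcoef a n + 1) + d * (fcoef a n ^+ N.+1 * fcoef a n ^+ N.+1
    - fcoef a n ^+ N.+1)); last first.
    by rewrite /V fcoefD fcoefB /= addn0 /e !exprS; ring.
  apply: ID; first by apply: IMr => //; inO.
  by apply: IM; [inO | apply: pow_idem].
have EZv : fI (E * Z * v - E).
  rewrite [X in fI X](_ : _ = E * (V * Z - 1) + Z * (E * E - E)); last first.
    by rewrite /V; ring.
  by apply: fID; apply: fIM => //; infO.
exists (E * Z), v; split=> //.
- by split; infO.
- split=> //; rewrite mulrA -mulrBl; exact: fIMr.
- rewrite [X in fR X](_ : _ = (E * a - fps_Xn A n * v) * Z + fps_Xn A n *
    ((E * Z * v - E) - (E * v - v) * Z) + fps_Xn A n * E); last ring.
  have RX : fR (fps_Xn A n).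
    by move=> k /=; case: eqP => _; inR.
  have OX : fO (fps_Xn A n) by apply: fRO.
  apply: (subringD fR_ring); last by infR.
  apply/fIR/fID; first by apply: fIMr.
  by apply: fIM => //; apply: fIB => //; apply: fIMr.
- have RXbv : fR (fps_Xn A n * (b * v)).
    rewrite [X in fR X](_ : _ = E * (a * b) - b * (E * a - fps_Xn A n * v));
      last ring.
    by apply: (subringB fR_ring); [infR | apply/fIR/fIM].
  move=> k; have := RXbv (n + k)%N.
  by rewrite fcoef_XnM ltnNge leq_addr /= addKn.
Qed.

(** Induction on [n]: the part of the support of the coefficient of degree [n]
    that is not yet covered by [e] is the idempotent of [splits_on_lead]. *)
Lemma splits_on_prefix a b n : fO a -> fO b -> fR (a * b) ->
  exists e, [/\ R e, I (e * e - e), splits_on a b (fps_const e) &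
    forall m, (m < n)%N -> I ((1 - e) * fcoef a m)].
Proof.
move=> Oa Ob Rab; elim: n => [|n [e [Re e2 se ea]]].
  exists 0; split=> //; first by inR.
  - by rewrite mulr0 subrr.
  - have c0 : fps_const 0 = 0 :> fps A by apply/fpsP => -[].
    have fI0 : fI 0 by case=> [|k]; apply: I0.
    by apply: splits_on_kernel; rewrite // ?c0 ?mul0r ?subr0 //; apply: fIR.
set x := fcoef a n; pose t := x ^+ N.+1.
have Ox : O x by apply: Oa.
have Rt : R t by apply: pow_in_R.
have It : I (t * t - t) by apply: pow_idem.
have Rd : R (1 - e) by inR.
have d2 : I ((1 - e) * (1 - e) - (1 - e)).
  by rewrite [X in I X](_ : _ = e * e - e) //; ring.
have sd := splits_on_lead Oa Ob Rab Rd d2 ea.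
rewrite -/x -/t in sd.
have ed : I (e * ((1 - e) * t)).
  rewrite [X in I X](_ : _ = - (e * e - e) * t); last ring.
  by apply: IMr; [apply: IN | inO].
exists (e + (1 - e) * t); split.
- by inR.
- rewrite [X in I X](_ : _ = (e * e - e) * (1 - t) * (1 - t)
    + (1 - e) * (t * t - t)); last ring.
  by apply: ID; [rewrite -mulrA; apply: IMr => //; inO | apply: IM => //; inO].
- rewrite fps_constD; apply: splits_on_add => //; try by infR; inR.
  by rewrite -fps_constM; apply: fI_const.
- have -> : 1 - (e + (1 - e) * t) = (1 - e) * (1 - t) by ring.
  move=> m; rewrite ltnS leq_eqVlt => /predU1P[->|mn]; last first.
    by rewrite mulrAC; apply: IMr; [apply: ea | inO].
  rewrite -mulrA; apply: IM; first by inO.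
  rewrite [X in I X](_ : _ = - (x ^+ N.+2 - x)); last by rewrite /t /x !exprS; ring.
  by apply/IN/O_pow.
Qed.

(** Modulo [I] the series [a] has only finitely many different coefficients, so
    killing a long enough prefix of [a] kills all of it. *)
Lemma splits_on_support a b : fO a -> fO b -> fR (a * b) ->
  exists e, [/\ R e, I (e * e - e), splits_on a b (fps_const e) &
    fI (fps_const (1 - e) * a)].
Proof.
move=> Oa Ob Rab; have [M aM] := O_fin Oa.
have [e [Re e2 se ea]] := splits_on_prefix M Oa Ob Rab.
exists e; split=> // n; have [m mM anm] := aM n; rewrite fcoef_cM.
rewrite -[fcoef a n](subrK (fcoef a m)) mulrDr.
by apply: ID; [apply: IM => //; inO | apply: ea].
Qed.

(** The idempotents [e] and [d] cover the supports of [a] and of [b]. What is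
    left outside of both is handled by [splits_on_kernel]. *)
Lemma splits_on1 a b : fO a -> fO b -> fR (a * b) -> splits_on a b 1.
Proof.
move=> Oa Ob Rab.
have [e [Re e2 se ea]] := splits_on_support Oa Ob Rab.
have [d [Rd d2 sd db]] : exists d, [/\ R d, I (d * d - d),
    splits_on a b (fps_const d) & fI (fps_const (1 - d) * b)].
  rewrite mulrC in Rab; have [d [? ? sd ?]] := splits_on_support Ob Oa Rab.
  by exists d; split=> //; apply: splits_on_sym.
pose E := fps_const e; pose D := fps_const d.
have RE : fR E by infR.
have RD : fR D by infR.
have E2 : fI (E * E - E) by rewrite -fps_constM -fps_constB; apply: fI_const.
have D2 : fI (D * D - D) by rewrite -fps_constM -fps_constB; apply: fI_const.
rewrite fps_constB -/E in ea; rewrite fps_constB -/D in db.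
have E'2 : fI ((1 - E) * (1 - E) - (1 - E)).
  by rewrite [X in fI X](_ : _ = E * E - E) //; ring.
have -> : 1 = E + (1 - E) * D + (1 - E) * (1 - D) by ring.
apply: splits_on_add; try by infR.
- rewrite [X in fI X](_ : _ = (E * E - E) * ((1 - D) * (D - 1))
     - (1 - E) * (D * D - D)); last ring.
  by apply: fIB; [apply: fIMr => //; infO | apply: fIM => //; infO].
- apply: splits_on_add => //; first by infR.
    rewrite [X in fI X](_ : _ = - D * (E * E - E)); last ring.
    by apply: fIM => //; apply: (subringN fO_ring); infO.
  by apply: splits_on_mul => //; infR.
- apply: splits_on_kernel => //; first by infR.
  + rewrite [X in fI X](_ : _ = (E * E - E) * ((1 - D) * (1 - D))
      + (1 - E) * (D * D - D)); last ring.
    by apply: fID; [apply: fIMr => //; infO | apply: fIM => //; infO].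
  + by rewrite mulrAC; apply: fIMr => //; infO.
  + by rewrite -mulrA; apply: fIM => //; infO.
Qed.

(** A series [w] invertible modulo [I] need not be invertible, as a unit modulo
    [I] need not lift to a unit of [O]. Its constant coefficient is [r * u]
    with [r] in [R] and [u] a unit of [O]; dividing by [r] modulo [I] keeps
    [a * w] over [R], and then the constant coefficient can be changed into [u]
    by adding an element of [I]. *)
Lemma unit_split a b : fO a -> fO b -> fR (a * b) ->
  exists w w', [/\ fO w, fO w', w * w' = 1, fR (a * w) & fR (b * w')].
Proof.
move=> Oa Ob Rab; have [w [w' [[Ow Ow'] ww' _ aw bw']]] := splits_on1 Oa Ob Rab.
have [r [u [Rr [Ou [v Ov uv]] w0]]] := OR (Ow 0%N).
have Iww0 : I (fcoef w 0 * fcoef w' 0 - 1).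
  have -> : fcoef w 0 * fcoef w' 0 - 1 = fcoef (w * w' - 1) 0; last exact: ww'.
  by rewrite [RHS]/= big_ord_recl big_ord0 addr0.
have Irs : I (r ^+ N.+1 - 1).
  apply: (@pow_unit r (u * fcoef w' 0)); [by inO | by inO; apply: Ow' |].
  by rewrite mulrA -w0.
(* [s] is the inverse of [r] modulo [I]. *)
pose s := r ^+ N; pose c := fcoef w 0 * s - u.
have Ic : I c.
  rewrite /c w0 [X in I X](_ : _ = u * (r ^+ N.+1 - 1)); first exact: IM.
  by rewrite /s exprS; ring.
have Rs : R s by inR.
pose W := fps_const s * w - fps_const c.
have OW : fO W by infO; apply: IO.
have W0 : fcoef W 0 * v = 1.
  by rewrite fcoefB fcoef_cM /= /c -uv; ring.
have [W' OW' WW'] := fps_inverse O_ring OW Ov W0.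
exists W, W'; split=> //.
- rewrite [X in fR X](_ : _ = fps_const s * (a * w) - a * fps_const c);
    last by rewrite /W; ring.
  by apply: (subringB fR_ring); [infR | apply/fIR/fIM => //; apply: fI_const].
- (* Modulo [I] the inverse of [W] is [w' * r]. *)
  have -> : b * W' = b * w' * fps_const r + b * W' * (1 - W * (w' * fps_const r)).
    rewrite mulrBr mulr1.
    rewrite [b * W' * (W * _)](_ : _ = W * W' * (b * w' * fps_const r)).
      by rewrite WW'; ring.
    by ring.
  apply: (subringD fR_ring); first by infR.
  apply/fIR/fIM; first by infO.
  rewrite [X in fI X](_ : _ = fps_const c * (w' * fps_const r)
    - fps_const (r ^+ N.+1 - 1) * (w * w') - (w * w' - 1)); last first.
    rewrite (fps_constB (r ^+ _)) exprSr fps_constM -/s /W.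
    by rewrite [fps_const 1](_ : _ = 1) //; ring.
  apply: fIB => //; apply: fIB; apply: fIMr; [exact: fI_const | | exact: fI_const |].
    by infO.
  by infO.
Qed.

End Splitting.

(** * The trace form bounds denominators of integers *)

(** The trace is the sum of the eigenvalues; they are roots of [p], hence
    algebraic integers, and a rational algebraic integer is an integer. *)
Lemma tr_int_of_monic n (M : 'M[rat]_n.+1) (p : {poly int}) :
  p \is monic -> horner_mx M (map_poly intr p) = 0 ->
  exists m : int, \tr M = m%:~R.
Proof.
move=> p_monic pM.
pose MC : 'M[algC]_n.+1 := map_mx ratr M.
have pE : map_poly ratr (map_poly intr p) = map_poly intr p :> {poly algC}.
  by rewrite -map_poly_comp; apply: eq_map_poly => m; rewrite /= ratr_int.
have pMC : horner_mx MC (map_poly intr p) = 0.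
  by rewrite -pE -map_horner_mx pM map_mx0.
have Aint_chi : char_poly MC \is a polyOver Aint.
  have [r chiE] := closed_field_poly_normal (char_poly MC).
  have r_Aint z : z \in r -> z \in Aint.
    move=> zr; apply: (@root_monic_Aint (map_poly intr p)).
    - have /dvdpP[q ->] := mxminpoly_min pMC.
      rewrite rootM root_mxminpoly chiE (monicP (char_poly_monic _)) scale1r.
      by rewrite root_prod_XsubC zr orbT.
    - by rewrite monic_map.
    - by apply/polyOverP => i; rewrite coef_map /= intr_int.
  rewrite chiE (monicP (char_poly_monic _)) scale1r big_seq.
  by apply: rpred_prod => z /r_Aint; rewrite polyOverXsubC.
have tr_Aint : ratr (\tr M) \in Aint.
  rewrite -[ratr _]opprK -trace_map_mx -char_poly_trace // rpredN.
  exact: (polyOverP Aint_chi).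
have /intrP[m trM] := Cint_rat_Aint (Crat_rat _) tr_Aint.
exists m; apply: (fmorph_inj (ratr : {rmorphism rat -> algC})).
by rewrite /= trM ratr_int.
Qed.

Section MultiplicationMatrix.
Variables (K : fieldExtType rat) (n : nat) (X : n.+1.-tuple K).
Hypothesis X_basis : basis_of {:K} X.
Implicit Types z : K.

(** The matrix, acting on row vectors of coordinates in the basis [X], of the
    multiplication by [z]. *)
Definition mulmat z : 'M[rat]_n.+1 := \matrix_(i, j) coord X j (X`_i * z).

Lemma mulmatD x y : mulmat (x + y) = mulmat x + mulmat y.
Proof. by apply/matrixP => i j; rewrite !mxE mulrDr linearD. Qed.

Lemma mulmatZ a x : mulmat (a *: x) = a *: mulmat x.
Proof. by apply/matrixP => i j; rewrite !mxE -scalerAr linearZ. Qed.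

Lemma mulmat1 : mulmat 1 = 1%:M.
Proof.
apply/matrixP => i j; rewrite !mxE mulr1 coord_free ?(basis_free X_basis) //.
Qed.

Lemma mulmatM x y : mulmat (x * y) = mulmat x *m mulmat y.
Proof.
apply/matrixP => i j; rewrite !mxE mulrA.
rewrite {1}(coord_basis X_basis (memvf (X`_i * x))) mulr_suml linear_sum.
by apply: eq_bigr => k _; rewrite -scalerAl linearZ !mxE.
Qed.

Lemma horner_mulmat z (p : {poly int}) :
  horner_mx (mulmat z) (map_poly intr p) = mulmat (map_poly intr p).[z].
Proof.
have mulmat_int m : mulmat m%:~R = (m%:~R)%:M.
  by rewrite -[m%:~R]scaler_int mulmatZ mulmat1 scale_scalar_mx mulr1.
elim/poly_ind: p => [|p c IH].
  by rewrite !rmorph0 horner0 (mulmat_int 0) raddf0.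
rewrite !rmorphD !rmorphM /= !map_polyX !map_polyC /= horner_mx_X horner_mx_C IH.
by rewrite hornerMXaddC mulmatD mulmatM mulmat_int.
Qed.

Definition mulmat_tr z := \tr (mulmat z).

Lemma mulmat_tr_int z :
  ring_of_integers z -> exists m : int, mulmat_tr z = m%:~R.
Proof.
move=> [p p_monic pz]; apply: tr_int_of_monic p_monic _.
by rewrite horner_mulmat (rootP pz) -(scale0r 0) mulmatZ scale0r.
Qed.

Lemma mulmat_trD x y : mulmat_tr (x + y) = mulmat_tr x + mulmat_tr y.
Proof. by rewrite /mulmat_tr mulmatD mxtraceD. Qed.

Lemma mulmat_trZ a x : mulmat_tr (a *: x) = a * mulmat_tr x.
Proof. by rewrite /mulmat_tr mulmatZ mxtraceZ. Qed.

Lemma mulmat_tr_sum (c : 'I_n.+1 -> rat) (v : 'I_n.+1 -> K) :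
  mulmat_tr (\sum_j c j *: v j) = \sum_j c j * mulmat_tr (v j).
Proof.
have tr0 : mulmat_tr 0 = 0 by rewrite -(scale0r 0) mulmat_trZ mul0r.
rewrite (big_morph _ mulmat_trD tr0).
by apply: eq_bigr => j _; rewrite mulmat_trZ.
Qed.

Definition trace_gram : 'M[rat]_n.+1 := \matrix_(i, j) mulmat_tr (X`_i * X`_j).

(** The trace form is nondegenerate in characteristic zero: it pairs a nonzero
    [y] with [y^-1] to the degree of [K]. *)
Lemma det_trace_gram : \det trace_gram != 0.
Proof.
apply/det0P => -[q q0 qG]; case/negP: q0; apply/eqP/rowP => i; rewrite mxE.
pose y := \sum_j q 0 j *: X`_j.
have y_orth x : mulmat_tr (y * x) = 0.
  rewrite (coord_basis X_basis (memvf x)) mulr_sumr.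
  under eq_bigr => j _ do rewrite -scalerAr.
  rewrite mulmat_tr_sum big1 // => j _.
  have := congr1 (fun v : 'rV_ _ => v 0 j) qG; rewrite !mxE => qGj.
  rewrite mulr_suml; under eq_bigr => k _ do rewrite -scalerAl.
  rewrite mulmat_tr_sum -[RHS](mulr0 (coord X j x)); congr (_ * _).
  by rewrite -[RHS]qGj; apply: eq_bigr => k _; rewrite mxE.
suff y0 : y = 0 by have /freeP := basis_free X_basis; apply.
apply/eqP/negP => /negP y0; have := y_orth y^-1.
rewrite divff // /mulmat_tr mulmat1 mxtrace1 => /eqP.
by rewrite pnatr_eq0.
Qed.

(** The coordinates of [z] solve a linear system whose matrix is the Gram matrix
    of the trace form and whose right-hand side lists the traces of the
    products of [z] with the basis. All of these are integers, so by Cramer's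
    rule the determinant of the Gram matrix is a denominator for every [z]. *)
Lemma ring_of_integers_denominator :
  (forall i : 'I_n.+1, ring_of_integers X`_i) ->
  exists2 d : int, d != 0 & forall z, ring_of_integers z ->
    exists c : 'I_n.+1 -> int, z *~ d = \sum_(i < n.+1) X`_i *~ c i.
Proof.
move=> OX.
have int_mx m (f : 'I_m -> 'I_n.+1 -> rat) :
    (forall i j, exists k : int, f i j = k%:~R) ->
    exists g : 'M[int]_(m, n.+1), map_mx intr g = \matrix_(i, j) f i j.
  move=> /(_ _ _)/cid fZ; exists (\matrix_(i, j) sval (fZ i j)).
  by apply/matrixP => i j; rewrite !mxE; case: (fZ i j).
have [G GE] : exists G : 'M[int]_n.+1, map_mx intr G = trace_gram.
  apply: int_mx => i j; apply: mulmat_tr_int => //.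
  exact: (integral_mul (OX i) (OX j)).
exists (\det G) => [|z Oz].
  by have := det_trace_gram; rewrite -GE det_map_mx intr_eq0.
have [t tE] : exists t : 'rV[int]_n.+1,
    map_mx intr t = \row_i mulmat_tr (z * X`_i).
  apply: int_mx => _ j; apply: mulmat_tr_int => //.
  exact: (integral_mul Oz (OX j)).
exists (fun j => (t *m \adj G) 0 j).
pose q : 'rV[rat]_n.+1 := \row_j coord X j z.
have qG : q *m trace_gram = map_mx intr t.
  apply/rowP => i; rewrite tE !mxE [in RHS](coord_basis X_basis (memvf z)) mulr_suml.
  under [in RHS]eq_bigr => j _ do rewrite -scalerAl.
  by rewrite mulmat_tr_sum; apply: eq_bigr => j _; rewrite !mxE.
have qd : (\det G)%:~R *: q = map_mx intr (t *m \adj G).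
  rewrite map_mxM -qG map_mx_adj GE -mulmxA mul_mx_adj -det_map_mx GE.
  by rewrite mul_mx_scalar.
rewrite -scaler_int {1}(coord_basis X_basis (memvf z)) scaler_sumr.
apply: eq_bigr => j _; rewrite scalerA -[in RHS]scaler_int; congr (_ *: _).
by have := congr1 (fun v : 'rV_ _ => v 0 j) qd; rewrite !mxE.
Qed.

End MultiplicationMatrix.

(** * Orders and their conductors *)

Section OrderConductor.
Variables (K : fieldExtType rat) (R : set K).

Lemma ring_of_integers_subring : subring_closed (mem (@ring_of_integers K)).
Proof.
split=> [|x y|x y]; rewrite ?in_setE; first exact: integral1.
- exact: integral_sub.
- exact: integral_mul.
Qed.

Lemma conductor_ideal : subring_closed (mem R) ->
  [/\ conductor R `<=` R,
      forall x y, conductor R x -> conductor R y -> conductor R (x + y),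
      forall t x, ring_of_integers t -> conductor R x -> conductor R (t * x) &
      conductor R 0].
Proof.
move=> R_ring; split=> [x [_ xR]|x y [Ox xR] [Oy yR]|t x Ot [Ox xR]|].
- by rewrite -(mulr1 x); apply: xR; apply: (subring1 ring_of_integers_subring).
- split=> [|s Os]; first exact: integral_add.
  by rewrite mulrDl; apply: (subringD R_ring); [apply: xR | apply: yR].
- split=> [|s Os]; first exact: integral_mul.
  by rewrite mulrAC mulrC; apply: xR; apply: integral_mul.
- split=> [|s _]; first exact: (subring0 ring_of_integers_subring).
  by rewrite mul0r; apply: (subring0 R_ring).
Qed.

(** Clearing denominators, independence over the integers is independence over
    the rationals. *)
Lemma Z_independent_basis n (e : 'I_n -> K) :
  Z_independent e -> n = \dim {:K} -> basis_of {:K} [tuple e i | i < n].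
Proof.
move=> e_ind nE; rewrite basisEfree subvf size_tuple -nE leqnn !andbT.
apply/freeP => k; under eq_bigr => i _ do rewrite nth_mktuple.
move=> ke0 i; pose c i := numq (k i) * \prod_(j | j != i) denq (k j).
have cE j : (c j)%:~R = (\prod_l denq (k l))%:~R * k j.
  by rewrite [in RHS](bigD1 j) //= !intrM numqE; ring.
have /(e_ind c)/(_ i)/eqP : \sum_j e j *~ c j = 0.
  under eq_bigr => j _ do rewrite -scaler_int cE -scalerA.
  by rewrite -scaler_sumr ke0 scaler0.
rewrite mulf_eq0 numq_eq0 => /orP[/eqP //|/prodf_eq0[j _]].
by rewrite denq_eq0.
Qed.

(** With [d] a common denominator for the integers of [K] in a basis taken from
    [R], [phi z] records the coordinates of [z *~ d] modulo [d ^+ 2]. If those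
    of [x] and [y] agree then [x - y] is [w *~ d] for some [w] in [R], and
    [(x - y) * s = w * (s *~ d)] is in [R] for every integer [s]. *)
Lemma order_conductor_finite : is_order R ->
  exists (T : finType) (phi : K -> T), forall x y,
    ring_of_integers x -> ring_of_integers y -> phi x = phi y ->
    conductor R (x - y).
Proof.
case=> R_ring RO [[e [Re e_ind]] _].
have := Z_independent_basis e_ind erefl.
have : (0 < \dim {:K})%N by rewrite adim_gt0.
case: (\dim {:K}) e Re {e_ind} => // n e Re _ e_basis.
have OX (i : 'I_n.+1) : ring_of_integers [tuple e i | i < n.+1]`_i.
  by rewrite nth_mktuple; apply: RO.
have [d d0 dO] := ring_of_integers_denominator e_basis OX.
pose c z : 'I_n.+1 -> int :=
  if pselect (ring_of_integers z) is left Oz then sval (cid (dO z Oz))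
  else fun=> 0.
have cE z : ring_of_integers z -> z *~ d = \sum_i e i *~ c z i.
  rewrite /c; case: pselect => // Oz _; case: (cid _) => /= c' ->.
  by apply: eq_bigr => i _; rewrite nth_mktuple.
have d2 : d ^+ 2 != 0 by rewrite expf_neq0.
pose D := `|d ^+ 2|%N; have D0 : (0 < D)%N by rewrite absz_gt0.
pose phi z := [ffun i => inord `|(c z i %% d ^+ 2)%Z| : 'I_D.-1.+1].
exists {ffun 'I_n.+1 -> 'I_D.-1.+1}, phi => x y Ox Oy /ffunP phixy.
have RZ (a : 'I_n.+1 -> int) : R (\sum_i e i *~ a i).
  apply: (subring_sum R_ring) => i _; rewrite -mulrzr.
  apply: (subringM R_ring) => //; apply: subring_int R_ring _.
have dOR z : ring_of_integers z -> R (z *~ d) by move=> Oz; rewrite cE.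
have cxy i : exists k, c x i - c y i = k * d ^+ 2.
  apply/dvdzP; rewrite -eqz_mod_dvd; apply/eqP.
  have c_lt z : (`|(c z i %% d ^+ 2)%Z| < D.-1.+1)%N.
    by rewrite prednK // -ltz_nat gez0_abs ?modz_ge0 // abszE ltz_mod.
  have := congr1 val (phixy i); rewrite !ffunE /= !inordK // => cxy.
  by rewrite -[LHS]gez0_abs ?modz_ge0 // cxy gez0_abs ?modz_ge0.
have [k kE] := choice cxy.
have xyE : x - y = (\sum_i e i *~ k i) *~ d.
  have dQ0 : d%:~R != 0 :> rat by rewrite intr_eq0.
  apply: (scalerI dQ0); rewrite !scaler_int mulrzBl (cE _ Ox) (cE _ Oy) -sumrB -mulrzA.
  rewrite -expr2 -mulrzr mulr_suml; apply: eq_bigr => i _.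
  by rewrite mulrzr -mulrzBr kE mulrzA.
split=> [|s Os]; first exact: integral_sub.
rewrite xyE mulrzAl -mulrzAr.
by apply: (subringM R_ring); [apply: RZ | apply: dOR].
Qed.

(** The inverse of [u], if integral, is a polynomial in [u] with integer
    coefficients: multiply a monic equation of degree [m.+1] for the inverse by
    [u ^+ m]. *)
Lemma order_unit u :
  is_order R -> R u -> units (@ring_of_integers K) u -> units R u.
Proof.
move=> [R_ring _ _] Ru [_ [v [p p_monic pv] uv]]; split=> //; exists v => //.
move: pv; rewrite /root horner_coef size_map_poly_id0; last first.
  by rewrite (monicP p_monic) oner_neq0.
have := monic_neq0 p_monic; rewrite -size_poly_gt0.
have := p_monic; rewrite monicE lead_coefE.
case: (size p) => [|[|m]] //= pm _.
  by rewrite big_ord1 coef_map /= (eqP pm) expr0 mulr1 oner_eq0.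
rewrite big_ord_recr /= coef_map /= (eqP pm) mul1r => /eqP pv.
have -> : v = - \sum_(i < m.+1) (p`_i)%:~R * u ^+ (m - i).
  have vE : v = v ^+ m.+1 * u ^+ m.
    by rewrite exprS -mulrA -exprMn [v * u]mulrC uv expr1n mulr1.
  apply/eqP; rewrite -addr_eq0 addrC [X in _ + X]vE; apply/eqP.
  transitivity ((\sum_(i < m.+1) (map_poly intr p)`_i * v ^+ i + v ^+ m.+1)
    * u ^+ m); last by rewrite pv mul0r.
  rewrite mulrDl mulr_suml; congr (_ + _).
  apply: eq_bigr => i _; rewrite coef_map /= -mulrA; congr (_ * _).
  have im : (i <= m)%N by rewrite -ltnS.
  rewrite -[X in _ * u ^+ X](subnKC im).
  by rewrite exprD mulrA -exprMn [v * u]mulrC uv expr1n mul1r.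
apply: (subringN R_ring); apply: (subring_sum R_ring) => i _.
by apply: (subringM R_ring); [apply: subring_int | apply: subringX].
Qed.

End OrderConductor.

(** * Finite quotients *)

Section FiniteQuotient.
Variables (A : comNzRingType) (O I : set A) (T : finType) (phi : A -> T).
Hypothesis phi_mod : forall x y, O x -> O y -> phi x = phi y -> I (x - y).

Lemma finite_quotient_seq (a : nat -> A) : (forall n, O (a n)) ->
  exists M, forall n, exists2 m, (m < M)%N & I (a n - a m).
Proof.
move=> Oa.
pose m t :=
  if pselect (exists n, phi (a n) = t) is left E then sval (cid E) else 0%N.
have mE n : phi (a (m (phi (a n)))) = phi (a n).
  by rewrite /m; case: pselect => [E|[]]; [case: (cid E) | exists n].
exists (\max_t m t).+1 => n; exists (m (phi (a n))).
  by rewrite ltnS; apply: leq_bigmax.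
exact: phi_mod.
Qed.

(** Among [C.+1] powers of [t] two agree in a quotient with at most [C]
    elements, and the exponent [C`!] is a period for all [t] at once. So some power of
    [t] kills [t ^+ C`! - 1] modulo [I], and radicality reduces it to [t]. *)
Lemma finite_quotient_pow : subring_closed (mem O) ->
  (forall t x, O t -> I x -> I (t * x)) ->
  (forall t n, O t -> I (t ^+ n.+1) -> I t) ->
  exists N, forall t, O t -> I (t ^+ N.+2 - t).
Proof.
move=> O_ring IM I_rad; pose C := #|T|.
exists C`!.-1 => t Ot.
have OX n : O (t ^+ n) by apply: subringX.
have [k [l [kl lC tkl]]] : exists k l,
    [/\ (k < l)%N, (l <= C)%N & I (t ^+ l - t ^+ k)].
  have /injectivePn[i [j ij phiij]] :
      ~~ injectiveb (fun i : 'I_C.+1 => phi (t ^+ i)).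
    by apply/negP => /injectiveP/leq_card; rewrite card_ord ltnn.
  have [ltij|ltji|/val_inj] := ltngtP i j; last by move/eqP; rewrite (negPf ij).
  - by exists i, j; split; rewrite ?ltij -1?ltnS //; apply: phi_mod.
  - by exists j, i; split; rewrite ?ltji -1?ltnS //; apply: phi_mod.
have /dvdnP[q qE] : (l - k %| C`!)%N.
  by apply: dvdn_fact; rewrite subn_gt0 kl (leq_trans (leq_subr _ _)).
apply: (I_rad _ C); first by apply: (subringB O_ring) => //; apply: OX.
have -> : t ^+ C`!.-1.+2 - t = t * (t ^+ C`! - 1).
  by rewrite mulrBr mulr1 -exprS prednK ?fact_gt0.
pose s := \sum_(i < q) (t ^+ (l - k)) ^+ i.
have Os : O s by apply: (subring_sum O_ring) => i _; rewrite -exprM; apply: OX.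
have sE : t ^+ C`! - 1 = (t ^+ (l - k) - 1) * s.
  by rewrite -subrX1 -exprM mulnC -qE.
rewrite exprMn [X in _ * X]exprSr [X in _ * (_ * X)]sE.
have kC : (k <= C.+1)%N by apply: leq_trans (ltnW kl) (leqW lC).
rewrite -(subnKC kC) exprD.
rewrite [X in I X](_ : _ = t ^+ (C.+1 - k) * (t ^+ C`! - 1) ^+ C * s *
    (t ^+ k * t ^+ (l - k) - t ^+ k)); last by ring.
rewrite -exprD subnKC ?(ltnW kl) //; apply: IM => //.
do 2!apply: (subringM O_ring) => //; apply: (subringX O_ring).
by apply: (subringB O_ring); [apply: OX | apply: subring1].
Qed.

End FiniteQuotient.

(** * Factorizations in a pair of rings with the splitting property *)

Section SplittingFactorizations.
Variables (L : comNzRingType) (D E : set L).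
Hypothesis D_ring : subring_closed (mem D).
Hypothesis E_ring : subring_closed (mem E).
Hypothesis DE : D `<=` E.
Hypothesis units_DE : forall u, D u -> units E u -> units D u.
Hypothesis split_DE : forall a b, E a -> E b -> D (a * b) ->
  exists w w', [/\ E w, E w', w * w' = 1, D (a * w) & D (b * w')].
Implicit Types a b f p u w : L.

Lemma units_sub u : units D u -> units E u.
Proof. by move=> [Du [v Dv uv]]; split; [apply: DE | exists v => //; apply: DE]. Qed.

Lemma units_factor a b : E a -> E b -> units E (a * b) -> units E a.
Proof.
move=> Ea Eb [_ [v Ev abv]]; split=> //; exists (b * v); last by rewrite mulrA.
exact: (subringM E_ring).
Qed.

Lemma irreducibles_mul_unit p w w' : E w -> E w' -> w * w' = 1 ->
  irreducibles E p -> irreducibles E (p * w).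
Proof.
move=> Ew Ew' ww' [[Ep p0 pU] p_irr].
have pww' : p * w * w' = p by rewrite -mulrA ww' mulr1.
split; first split.
- exact: (subringM E_ring).
- by move=> pw0; apply: p0; rewrite -pww' pw0 mul0r.
- by move=> /units_factor pU'; apply: pU; apply: pU'.
- move=> a b Ea Eb pwE.
  have Ebw' : E (b * w') by apply: (subringM E_ring).
  case: (p_irr a (b * w') Ea Ebw'); first by rewrite mulrA -pwE.
    by left.
  by move=> /units_factor bU; right; apply: bU.
Qed.

(** A factorization of [p] in [E] is moved into [D] by a unit of [E], which does
    not affect whether a factor is a unit. *)
Lemma irreducibles_sub p : irreducibles D p -> irreducibles E p.
Proof.
move=> [[Dp p0 pU] p_irr]; split=> [|a b Ea Eb pE].
  by split=> //; [apply: DE | move=> /(units_DE Dp)].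
have [w [w' [Ew Ew' ww' Daw Dbw']]] : exists w w',
    [/\ E w, E w', w * w' = 1, D (a * w) & D (b * w')].
  by apply: split_DE; rewrite -?pE.
have : p = (a * w) * (b * w') by rewrite mulrACA ww' mulr1.
by move=> /(p_irr _ _ Daw Dbw')[] /units_sub /units_factor xU; [left|right]; apply: xU.
Qed.

Lemma irreducibles_restrict p : D p -> irreducibles E p -> irreducibles D p.
Proof.
move=> Dp [[Ep p0 pU] p_irr]; split=> [|a b Da Db pE].
  by split=> // /units_sub.
by case: (p_irr a b (DE Da) (DE Db) pE) => /units_DE; [left|right]; auto.
Qed.

Lemma lengthsP (B : set L) f n : lengths B f n <->
  exists s, [/\ size s = n, forall p, p \in s -> irreducibles B p &
    f = \prod_(p <- s) p].
Proof.
split=> [[p [p_irr ->]]|[s [<- s_irr ->]]].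
  exists [seq p i | i : 'I_n]; split.
  - by rewrite size_map -cardT card_ord.
  - by move=> _ /mapP[i _ ->].
  - by rewrite big_map enumT.
exists (tnth (in_tuple s)); split=> [i|]; last by rewrite [LHS]big_tnth.
by apply: s_irr; apply: mem_tnth.
Qed.

(** Splitting off the first factor costs a unit [w'], which is absorbed by the
    second factor; the rest of the product is then treated in the same way. *)
Lemma lengths_restrict f n : D f -> ~ units D f ->
  lengths E f n -> lengths D f n.
Proof.
move=> Df fU /lengthsP[s [<- s_irr fE]]; apply/lengthsP.
case: s s_irr fE => [_ fE|p s].
  case: fU; rewrite fE big_nil; split; first exact: subring1.
  by exists 1; rewrite ?mulr1 //; apply: subring1.
elim: s p f Df {fU} => [|q s IH] p f Df s_irr fE.
  exists [:: p]; split=> // _ /predU1P[->|//].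
  apply: irreducibles_restrict; first by move: Df; rewrite fE big_seq1.
  by apply: s_irr; rewrite inE eqxx.
have p_irr : irreducibles E p by apply: s_irr; rewrite inE eqxx.
have q_irr : irreducibles E q by apply: s_irr; rewrite !inE eqxx orbT.
have {}s_irr x : x \in s -> irreducibles E x.
  by move=> xs; apply: s_irr; rewrite !inE xs !orbT.
have E_irr x : irreducibles E x -> E x by case=> -[].
pose b := \prod_(x <- q :: s) x.
have Eb : E b.
  rewrite /b big_cons; apply: (subringM E_ring); first exact: E_irr.
  rewrite big_seq; apply: (big_ind E) => [|x y|x /s_irr/E_irr //].
    exact: (subring1 E_ring).
  exact: (subringM E_ring).
have fpb : f = p * b by rewrite fE big_cons.
have [w [w' [Ew Ew' ww' Dpw Dbw']]] : exists w w',
    [/\ E w, E w', w * w' = 1, D (p * w) & D (b * w')].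
  by apply: split_DE => //; [apply: E_irr | rewrite -fpb].
have [||t [tn t_irr tE]] := IH (q * w') (b * w') Dbw'.
- move=> x; rewrite inE => /predU1P[->|]; last exact: s_irr.
  by apply: (irreducibles_mul_unit Ew' Ew _ q_irr); rewrite mulrC.
- by rewrite /b !big_cons mulrAC.
exists (p * w :: t); split; first by rewrite /= tn.
- move=> x; rewrite inE => /predU1P[->|]; last exact: t_irr.
  apply: irreducibles_restrict => //.
  exact: (irreducibles_mul_unit Ew Ew' ww' p_irr).
- by rewrite big_cons -tE mulrACA ww' mulr1.
Qed.

Lemma lengths_eq f : D f -> ~ units D f -> lengths D f = lengths E f.
Proof.
move=> Df fU; apply/seteqP; split=> n; last exact: lengths_restrict.
by move=> [p [p_irr fE]]; exists p; split=> // i; apply/irreducibles_sub.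
Qed.

Lemma lengths_mul_unit f w w' : E w -> E w' -> w * w' = 1 -> ~ units E f ->
  lengths E (f * w) = lengths E f.
Proof.
have sub g v v' : E v -> E v' -> v * v' = 1 -> ~ units E g ->
    lengths E g `<=` lengths E (g * v).
  move=> Ev Ev' vv' gU n /lengthsP[[|p s] [<- s_irr gE]].
    case: gU; rewrite gE big_nil; split; first exact: subring1.
    by exists 1; rewrite ?mulr1 //; apply: subring1.
  apply/lengthsP; exists (p * v :: s); split=> //.
    move=> x; rewrite inE => /predU1P[->|xs].
      apply: (irreducibles_mul_unit Ev Ev' vv').
      by apply: s_irr; rewrite inE eqxx.
    by apply: s_irr; rewrite inE xs orbT.
  by rewrite gE !big_cons mulrAC.
move=> Ew Ew' ww' fU; apply/seteqP; split; last exact: sub ww' fU.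
have fww' : f * w * w' = f by rewrite -mulrA ww' mulr1.
rewrite -[X in _ `<=` lengths E X]fww'; apply: (sub _ w' w) => //; first by rewrite mulrC.
move=> [Efw [v Ev fwv]]; apply: fU; split.
  by rewrite -fww'; apply: (subringM E_ring).
by exists (w * v); [apply: (subringM E_ring) | rewrite mulrA].
Qed.

Lemma elasticity_at_eq (F : realType) f : nonzero_nonunit D f ->
  elasticity_at F D f = elasticity_at F E f.
Proof. by case=> Df _ fU; rewrite /elasticity_at lengths_eq. Qed.

(** Splitting the product [f * 0] yields an associate of [f] that lies in
    [D]. *)
Lemma elasticity_eq (F : realType) : elasticity F D = elasticity F E.
Proof.
rewrite /elasticity; congr ereal_sup; apply/seteqP; split=> _ [f [Df f0 fU] <-].
  exists f; last by rewrite elasticity_at_eq.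
  by split=> //; [apply: DE | move=> /(units_DE Df)].
have [w [w' [Ew Ew' ww' Dfw _]]] : exists w w',
    [/\ E w, E w', w * w' = 1, D (f * w) & D (0 * w')].
  by apply: split_DE => //; rewrite ?mulr0; apply: subring0.
have fww' : f * w * w' = f by rewrite -mulrA ww' mulr1.
have nn : nonzero_nonunit D (f * w).
  split=> // [fw0|/units_sub/units_factor fU']; last by apply: fU; apply: fU'.
  by apply: f0; rewrite -fww' fw0 mul0r.
exists (f * w) => //; rewrite elasticity_at_eq // /elasticity_at.
by rewrite (lengths_mul_unit Ew Ew' ww' fU).
Qed.

End SplittingFactorizations.

(** * The theorem *)

Theorem theorem4p5 (F : realType) (K : fieldExtType rat) (R : set K)
    (R_order : is_order R)
    (R_associated : is_associated R)
    (I_radical : is_radical (@ring_of_integers K) (conductor R)) :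
  (forall f : fps K, nonzero_nonunit (fps_over R) f ->
     elasticity_at F (fps_over R) f =
     elasticity_at F (fps_over (@ring_of_integers K)) f) /\
  elasticity F (fps_over R) = elasticity F (fps_over (@ring_of_integers K)).
Proof.
have [R_ring RO _] := R_order; have O_ring := ring_of_integers_subring K.
have [IR ID IM I0] := conductor_ideal R_ring.
have [T [phi phi_mod]] := order_conductor_finite R_order.
have I_rad t n : ring_of_integers t -> conductor R (t ^+ n.+1) -> conductor R t.
  by move=> Ot Itn; rewrite -I_radical; split=> //; exists n.+1.
have [N O_pow] := finite_quotient_pow phi_mod O_ring IM I_rad.
have split_OR := unit_split O_ring R_ring RO IR ID IM I0 O_pow R_associated
  (finite_quotient_seq phi_mod).
have fO_ring := subring_closed_fps_over O_ring.
have fR_ring := subring_closed_fps_over R_ring.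
have fRO : fps_over R `<=` fps_over (@ring_of_integers K).
  by move=> f Rf n; apply: RO.
have fps_units :=
  fps_over_units R_ring (fun u => order_unit (u := u) R_order).
split; last exact: (elasticity_eq fR_ring fO_ring fRO fps_units split_OR F).
exact: (elasticity_at_eq fR_ring fO_ring fRO fps_units split_OR F).
Qed.
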